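(* Let $\mathbf{F}$ be a free group of finite rank $r\ge1$. For every word $w\in\mathbf{F}$ and every prime power $q$, $$\pi_q(w)\le\pi(w).$$
   Context: Let $K$ be the finite field of order $q$ and $\mathcal{A}=K[\mathbf{F}]$ the group algebra. By a theorem of Cohn and Lewin, every right ideal $I\le\mathcal{A}$ is a free right $\mathcal{A}$-module whose bases all have the same cardinality, denoted $\mathrm{rk}\,I$. An element $f\in I$ is primitive in $I$ if it belongs to some basis of $I$ as a free right $\mathcal{A}$-module, and imprimitive in $I$ otherwise. The $q$-primitivity rank of $w$ is $$\pi_q(w)=\min\{\mathrm{rk}\,I\mid I\lneqq\mathcal{A}\text{ a proper right ideal},\ w-1\in I,\ w-1\text{ imprimitive in }I\},$$ with $\pi_q(w)=\infty$ if this set is empty. The primitivity rank $\pi(w)$ is the smallest rank of a subgroup $H\le\mathbf{F}$ containing $w$ as an imprimitive element (that is, $w\in H$ and $w$ does not belong to any basis of the free group $H$), with $\pi(w)=\infty$ if there is no such subgroup. *)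

(* Defs.v *)
From HB Require Import structures.
From mathcomp Require Import all_boot all_order all_algebra.
From mathcomp Require Import finmap monalg.
From mathcomp Require Import boolp classical_sets functions cardinality.

Set Implicit Arguments.
Unset Strict Implicit.
Unset Printing Implicit Defensive.

Import GRing.Theory.
Local Open Scope classical_set_scope.
Local Open Scope ring_scope.

(* N with a top element: [None] stands for infinity. *)
Definition natinf := option nat.

Definition le_natinf (a b : natinf) : bool :=
  match a, b with
  | _, None => true
  | None, Some _ => false
  | Some m, Some n => (m <= n)%N
  end.

Definition min_natinf (S : set nat) : natinf :=
  match pselect (exists n, `[< S n >]) with
  | left exS => Some (ex_minn exS)
  | right _ => None
  end.

Section FreeGroups.
Variable F : groupType.
Local Open Scope group_scope.
Implicit Types (H X : set F) (w : seq (F * bool)).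

Definition subgroup H := H 1 /\ forall x y, H x -> H y -> H (x * y^-1).

(* The letter (x, false) stands for x, and (x, true) for x^-1. *)
Definition letter_val (a : F * bool) : F := if a.2 then a.1^-1 else a.1.

Definition word_val w : F := \prod_(a <- w) letter_val a.

Definition word_in X w := forall a, a \in w -> X a.1.

Definition reduced_word w : bool :=
  sorted (fun a b => (a.1 != b.1) || (a.2 == b.2)) w.

Definition group_basis H X :=
  [/\ X `<=` H,
      forall h, H h -> exists2 w, word_in X w & h = word_val w
    & forall w, word_in X w -> reduced_word w -> w <> [::] -> word_val w <> 1].

(* [group_rank H n]: the subgroup H is free of finite rank n. *)
Definition group_rank H (n : nat) := exists2 X, group_basis H X & (X #= `I_n)%card.

Definition group_primitive H (x : F) := exists2 X, group_basis H X & X x.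

Definition is_free_group_of_rank (n : nat) := group_rank setT n.

(* A subgroup without finite basis never lowers the minimum, so only subgroups
   of finite rank are listed; likewise in [q_primitivity_rank]. *)
Definition primitivity_rank (x : F) : natinf :=
  min_natinf [set n | exists H,
    [/\ subgroup H, group_rank H n, H x & ~ group_primitive H x]].

End FreeGroups.

Section GroupAlgebra.
Variables (K : nzRingType) (F : groupType).

(* [monalg] provides the ring structure only over monoids in which x * y = 1
   forces x = y = 1, so the convolution product is redone here. *)
Definition group_algebra := {malg K[F]}.

HB.instance Definition _ := GRing.Lmodule.on group_algebra.

Local Notation A := group_algebra.
Implicit Types g : A.

Definition group_elt (x : F) : A := << x >>.

Definition ga_mul g1 g2 : A :=
  \sum_(x <- msupp g1) \sum_(y <- msupp g2) << g1@_x * g2@_y *g (x * y)%g >>.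

Lemma ga_mulw (d1 d2 : {fset F}) g1 g2 :
  (msupp g1 `<=` d1)%fset -> (msupp g2 `<=` d2)%fset ->
  ga_mul g1 g2 =
    \sum_(x <- d1) \sum_(y <- d2) << g1@_x * g2@_y *g (x * y)%g >>.
Proof.
move=> le_d1 le_d2; rewrite /ga_mul (big_fset_incl _ le_d1) /=.
  apply/eq_bigr=> x _; apply/big_fset_incl => // y _ /mcoeff_outdom ->.
  by rewrite mulr0 monalgU0.
move=> x _ /mcoeff_outdom g1x.
by rewrite big1 // => y _; rewrite g1x mul0r monalgU0.
Qed.

Fact ga_mulUU c1 c2 x1 x2 :
  ga_mul << c1 *g x1 >> << c2 *g x2 >> = << c1 * c2 *g (x1 * x2)%g >>.
Proof. by rewrite (ga_mulw msuppU_le msuppU_le) !big_seq_fset1 !mcoeffUU. Qed.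

Fact ga_mulDl : left_distributive ga_mul +%R.
Proof.
move=> g1 g2 g; rewrite (ga_mulw (msuppD_le _ _) (fsubset_refl _)).
rewrite (ga_mulw (fsubsetUl _ (msupp g2)) (fsubset_refl _)).
rewrite (ga_mulw (fsubsetUr (msupp g1) _) (fsubset_refl _)) -big_split /=.
apply/eq_bigr=> x _; rewrite -big_split /=; apply/eq_bigr=> y _.
by rewrite mcoeffD mulrDl monalgUD.
Qed.

Fact ga_mulDr : right_distributive ga_mul +%R.
Proof.
move=> g g1 g2; rewrite (ga_mulw (fsubset_refl _) (msuppD_le _ _)).
rewrite (ga_mulw (fsubset_refl _) (fsubsetUl _ (msupp g2))).
rewrite (ga_mulw (fsubset_refl _) (fsubsetUr (msupp g1) _)) -big_split /=.
apply/eq_bigr=> x _; rewrite -big_split /=; apply/eq_bigr=> y _.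
by rewrite mcoeffD mulrDr monalgUD.
Qed.

Fact ga_mul0l : left_zero 0 ga_mul.
Proof. by move=> g; rewrite /ga_mul msupp0 big_seq_fset0. Qed.

Fact ga_mul0r : right_zero 0 ga_mul.
Proof. by move=> g; rewrite /ga_mul big1 // => x _; rewrite msupp0 big_seq_fset0. Qed.

Let ga_suml g (s : seq F) (f : F -> A) :
  ga_mul (\sum_(x <- s) f x) g = \sum_(x <- s) ga_mul (f x) g.
Proof. exact: (big_morph (ga_mul^~ g) (fun _ _ => ga_mulDl _ _ _) (ga_mul0l _)). Qed.

Let ga_sumr g (s : seq F) (f : F -> A) :
  ga_mul g (\sum_(x <- s) f x) = \sum_(x <- s) ga_mul g (f x).
Proof. exact: (big_morph (ga_mul g) (fun _ _ => ga_mulDr _ _ _) (ga_mul0r _)). Qed.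

Fact ga_mulA : associative ga_mul.
Proof.
move=> g1 g2 g3; move: ga_suml ga_sumr ga_mulUU.
move: ga_mul => mul suml sumr mulUU.
rewrite [g1]monalgE !suml; apply/eq_bigr=> x _.
rewrite [g2]monalgE suml !sumr suml; apply/eq_bigr=> y _.
rewrite [g3]monalgE !sumr; apply/eq_bigr=> z _.
by rewrite !mulUU mulrA mulgA.
Qed.

Fact ga_mul1l : left_id (group_elt 1%g) ga_mul.
Proof.
move=> g; rewrite {1}[g]monalgE ga_sumr [RHS]monalgE; apply/eq_bigr=> x _.
by rewrite ga_mulUU mul1r mul1g.
Qed.

Fact ga_mul1r : right_id (group_elt 1%g) ga_mul.
Proof.
move=> g; rewrite {1}[g]monalgE ga_suml [RHS]monalgE; apply/eq_bigr=> x _.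
by rewrite ga_mulUU mulr1 mulg1.
Qed.

Fact ga_1_neq0 : group_elt 1%g != 0.
Proof. by rewrite monalgU_eq0 oner_eq0. Qed.

HB.instance Definition _ := GRing.Zmodule_isNzRing.Build group_algebra
  ga_mulA ga_mul1l ga_mul1r ga_mulDl ga_mulDr ga_1_neq0.

End GroupAlgebra.

Section RightIdeals.
Variable A : nzRingType.
Implicit Types (I B : set A) (f : A).

Definition right_ideal I :=
  [/\ I 0, forall f g, I f -> I g -> I (f + g) & forall f a, I f -> I (f * a)].

Definition right_generates B I :=
  B `<=` I /\ forall f, I f ->
    exists (s : seq A) (c : A -> A), [set` s] `<=` B /\ f = \sum_(b <- s) b * c b.

Definition right_independent B :=
  forall (s : seq A) (c : A -> A), uniq s -> [set` s] `<=` B ->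
    \sum_(b <- s) b * c b = 0 -> forall b, b \in s -> c b = 0.

Definition ideal_basis I B := right_generates B I /\ right_independent B.

(* [ideal_rank I n]: I is free of finite rank n as a right module. *)
Definition ideal_rank I (n : nat) := exists2 B, ideal_basis I B & (B #= `I_n)%card.

Definition ideal_primitive I f := exists2 B, ideal_basis I B & B f.

End RightIdeals.

(* The number q enters only as the cardinality of K. *)
Definition q_primitivity_rank (K : finFieldType) (F : groupType) (w : F) :
    natinf :=
  let f : group_algebra K F := group_elt K w - 1 in
  min_natinf [set n | exists I : set (group_algebra K F),
    [/\ right_ideal I, I <> setT, ideal_rank I n, I f & ~ ideal_primitive I f]].

(* Main.v *)
Require Import Defs.
From mathcomp Require Import all_boot all_order all_algebra.
From mathcomp Require Import finmap monalg.
From mathcomp Require Import boolp classical_sets cardinality.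

(** Let H be a subgroup with a finite basis e_1, ..., e_n, and let I be the right
    ideal of K[F] generated by the e_i - 1, which contains h - 1 for all h in H.
    The augmentation vanishes on I, so I is proper. The e_i - 1 form a basis of
    I ([fox_independent]): a relation between them is a finitely supported cycle
    in a disjoint union of copies of the Cayley tree of H. So I has rank n, and
    it remains to see that if w - 1 is primitive in I then w is primitive in H
    ([ideal_primitive_group_primitive]): every rank that competes in the
    definition of the primitivity rank of w then competes in that of its
    q-primitivity rank.

    If w - 1 lies in a basis of I, its coordinate function yields a derivation
    D : H -> K[F], that is D(gh) = D(g)h + D(h), with D(w) = 1. Let f(g) be the
    coefficient of g in D(g). Then f(gh) - f(g) is the coefficient of gh in D(h),
    which is zero for all but finitely many g; and f(gw) = f(g) unless gw = 1,
    in which case f(gw) = f(g) + 1. So f is eventually constant along every ray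
    of the Cayley tree of H. It colours the ends of this tree in such a way that
    exactly one translate of the axis of w has ends of different colours.

    The existence of such an f makes w primitive
    ([separating_function_primitive]). Among all bases of H choose one in which
    w is written as a word a_1 ... a_m of minimal length, and assume m >= 2. The
    Whitehead graph of this word has as vertices the letters that occur in it
    and their inverses, and as edges the pairs (a_i^-1, a_(i+1)), with i taken
    modulo m; it records how the translates of the axis of w pass through a
    vertex of the tree. By Whitehead's cut vertex argument, minimality implies
    that this graph stays connected when a vertex ([shortest_connected]) or the
    closing edge (a_m^-1, a_1) ([shortest_bridgeless]) is removed. Suppose that
    the colour of an end is determined by its first N + 1 letters, and let p be
    a word of length N >= 1. The translates of the axis through p that do not
    pass through the edge from p towards the origin have both ends of the same
    colour, and by connectedness they link all branches beyond p; so N letters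
    suffice ([determined_descend]). Descending to N = 1, the same argument at the
    origin, with the closing edge removed, gives both ends of the exceptional
    translate the same colour, a contradiction. *)

Set Implicit Arguments.
Unset Strict Implicit.
Unset Printing Implicit Defensive.

Import GRing.Theory.

(** * Reduced words and free families *)

Section Words.
Variable I : eqType.
Local Notation letter := (I * bool)%type.
Local Notation word := (seq letter).
Implicit Types (a b c d : letter) (u v : word).

Definition linv a : letter := (a.1, ~~ a.2).

Definition nocancel a b := b != linv a.

Definition reduced u := sorted nocancel u.

Definition winv u : word := rev (map linv u).

Lemma linvK : involutive linv.
Proof. by case=> i b; rewrite /linv /= negbK. Qed.

Lemma linv_neq a : linv a != a.
Proof. by case: a => i [] ; rewrite /linv xpair_eqE /= andbF. Qed.

Lemma linv_eq a b : (linv a == b) = (a == linv b).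
Proof. by rewrite -(inj_eq (inv_inj linvK)) linvK. Qed.

Lemma nocancelE a b : nocancel a b = (a.1 != b.1) || (a.2 == b.2).
Proof.
case: a b => i x [j y]; rewrite /nocancel /linv xpair_eqE negb_and /=.
rewrite [j == i]eq_sym.
by case: x y => [] [].
Qed.

Lemma nocancel_linv a b : nocancel (linv a) (linv b) = nocancel b a.
Proof. by rewrite /nocancel linvK linv_eq eq_sym linv_eq. Qed.

Lemma winv_cat u v : winv (u ++ v) = winv v ++ winv u.
Proof. by rewrite /winv map_cat rev_cat. Qed.

Lemma winv_cons a u : winv (a :: u) = rcons (winv u) (linv a).
Proof. by rewrite /winv /= rev_cons. Qed.

Lemma winv_rcons u a : winv (rcons u a) = linv a :: winv u.
Proof. by rewrite /winv map_rcons rev_rcons. Qed.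

Lemma reduced_cat u v : reduced (u ++ v) ->
  reduced u /\ reduced v.
Proof. by case/cat_sorted2. Qed.

Lemma reduced_cons a u : reduced (a :: u) -> reduced u.
Proof. exact: path_sorted. Qed.

Lemma reduced_winv u : reduced u -> reduced (winv u).
Proof.
rewrite /winv /reduced => ru; rewrite rev_sorted sorted_map.
by apply: sub_sorted ru => a b; rewrite /= nocancel_linv.
Qed.

Lemma reduced_cat_cons u a v :
  reduced (rcons u a) -> reduced (a :: v) -> reduced (u ++ a :: v).
Proof.
case: u => [//|b u]; rewrite /reduced -cat_rcons /= => ru rv.
by rewrite cat_path last_rcons ru.
Qed.

End Words.

Section FreeFamilies.
Variables (F : groupType) (I : eqType).
Local Notation word := (seq (I * bool)).
Local Open Scope group_scope.
Implicit Types (e : I -> F) (a b : I * bool) (u v : word) (H : set F).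

Definition lval e a : F := if a.2 then (e a.1)^-1 else e a.1.

Definition wval e u : F := \prod_(a <- u) lval e a.

Definition free_family H e :=
  [/\ forall i, H (e i),
      forall h, H h -> exists u, h = wval e u
    & forall u, reduced u -> wval e u = 1 -> u = [::]].

Lemma wval_nil e : wval e [::] = 1. Proof. exact: big_nil. Qed.

Lemma wval_cons e a u : wval e (a :: u) = lval e a * wval e u.
Proof. exact: big_cons. Qed.

Lemma wval_cat e u v : wval e (u ++ v) = wval e u * wval e v.
Proof. exact: big_cat. Qed.

Lemma wval1 e a : wval e [:: a] = lval e a.
Proof. by rewrite wval_cons wval_nil mulg1. Qed.

Lemma wval_rcons e u a : wval e (rcons u a) = wval e u * lval e a.
Proof. by rewrite -cats1 wval_cat wval1. Qed.

Lemma lval_linv e a : lval e (linv a) = (lval e a)^-1.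
Proof. by case: a => i [] //=; rewrite /lval /= invgK. Qed.

Lemma wval_winv e u : wval e (winv u) = (wval e u)^-1.
Proof.
elim: u => [|a u IHu]; first by rewrite wval_nil invg1.
by rewrite winv_cons wval_rcons wval_cons IHu lval_linv invgM.
Qed.

Lemma wval_cat_winv e u v : wval e (u ++ winv v) = wval e u * (wval e v)^-1.
Proof. by rewrite wval_cat wval_winv. Qed.

Lemma eq_wval e e' u : (forall i, e i = e' i) -> wval e u = wval e' u.
Proof. by move=> ee'; apply: eq_bigr => a _; rewrite /lval ee'. Qed.

(** The reduced word is chosen independently of the family it is evaluated in,
    which is what makes a relation in one free family hold in all families. *)
Lemma reduced_form u :
  exists2 v, reduced v & forall e, wval e v = wval e u.
Proof.
elim: u => [|a u [v rv vE]]; first by exists [::].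
case: v rv vE => [|b v] rv vE.
  by exists [:: a] => // e; rewrite !wval_cons vE.
have [ab|ab] := boolP (nocancel a b).
  exists [:: a, b & v]; first by rewrite /reduced /= ab.
  by move=> e; rewrite wval_cons vE -wval_cons.
exists v; first exact: reduced_cons rv.
move: ab; rewrite negbK => /eqP bE e.
by rewrite wval_cons -vE wval_cons bE lval_linv mulVKg.
Qed.

Lemma free_family_relation H e e' u :
  free_family H e -> wval e u = 1 -> wval e' u = 1.
Proof.
case=> _ _ fe u1; have [v rv vE] := reduced_form u.
by rewrite -vE; move: (vE e); rewrite u1 => /(fe v rv) ->; rewrite wval_nil.
Qed.

Lemma subgroup_V H x : subgroup H -> H x -> H x^-1.
Proof. by case=> H1 HB Hx; rewrite -[_^-1]mul1g; apply: HB. Qed.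

Lemma subgroup_M H x y : subgroup H -> H x -> H y -> H (x * y).
Proof.
by move=> sgH Hx Hy; rewrite -[y]invgK; apply: sgH.2 => //; apply: subgroup_V.
Qed.

Lemma wval_subgroup H e u : subgroup H -> (forall i, H (e i)) -> H (wval e u).
Proof.
move=> sgH He; elim: u => [|a u IHu]; first by rewrite wval_nil; case: sgH.
rewrite wval_cons; apply: subgroup_M => //; rewrite /lval; case: a.2 => //.
exact: subgroup_V.
Qed.

Lemma wval_conj e t u :
  wval (fun i => t * e i * t^-1) u = t * wval e u * t^-1.
Proof.
elim: u => [|a u IHu]; first by rewrite !wval_nil mulg1 mulgV.
rewrite !wval_cons IHu /lval; case: a.2 => //;
  by rewrite ?invgM ?invgK !mulgA mulgVK.
Qed.

Lemma reduced_wval_inj H e : free_family H e ->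
  {in [pred u | reduced u] &, injective (wval e)}.
Proof.
case=> _ _ fe; elim=> [|a u IHu] v ru rv uv.
  by apply/esym/fe => //; rewrite -uv wval_nil.
case: v rv uv => [|b v] rv uv; first by apply: fe => //; rewrite uv wval_nil.
have [eab|nab] := eqVneq a b.
  rewrite eab; congr (_ :: _); apply: IHu; rewrite ?inE.
  - exact: reduced_cons ru.
  - exact: reduced_cons rv.
  - by move: uv; rewrite !wval_cons eab => /mulgI.
have : reduced (winv (a :: u) ++ b :: v).
  rewrite winv_cons cat_rcons; apply: reduced_cat_cons.
    by rewrite -winv_cons; apply: reduced_winv.
  by rewrite /reduced /= /nocancel linvK eq_sym nab.
move/fe; rewrite wval_cat wval_winv uv mulVg => /(_ erefl) /(congr1 size).
by rewrite size_cat /= addnS.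
Qed.

(** Basis changes: [sig] and [tau] describe mutually inverse substitutions, so
    a relation of [e'] pulls back, through the universal property of [e], to the
    same relation of [e]. *)
Lemma free_family_subst H e e' (sig tau : I -> word) :
  subgroup H -> free_family H e ->
  (forall i, e' i = wval e (sig i)) ->
  (forall i, e i = wval e' (tau i)) ->
  (forall i, wval (fun j => wval e (tau j)) (sig i) = e i) ->
  free_family H e'.
Proof.
pose subst (s : I -> word) u :=
  flatten [seq (if a.2 then winv (s a.1) else s a.1) | a <- u].
have substE (f : I -> F) s u :
    wval f (subst s u) = wval (fun j => wval f (s j)) u.
  elim: u => [|a u IHu]; first by rewrite !wval_nil.
  rewrite /subst /= wval_cat -/(subst s u) IHu wval_cons; congr (_ * _).
  by rewrite /lval; case: a.2; rewrite ?wval_winv.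
move=> sgH fe e'E eE tauK; have [He ge fre] := fe; split=> [i|h /ge[u ->]|u ru].
- by rewrite e'E; apply: wval_subgroup.
- by exists (subst tau u); rewrite substE; apply: eq_wval.
rewrite (eq_wval _ e'E) -substE.
move=> /(free_family_relation (fun j => wval e (tau j)) fe); rewrite substE.
by rewrite (eq_wval _ tauK); apply: fre.
Qed.

Lemma free_family_conj H e t :
  subgroup H -> free_family H e -> H t -> free_family H (fun i => t * e i * t^-1).
Proof.
move=> sgH [He ge fre] Ht; split=> [i|h Hh|u ru].
- exact: (subgroup_M sgH (subgroup_M sgH Ht (He i)) (subgroup_V sgH Ht)).
- have /ge[u uE] : H (t^-1 * h * t).
    exact: (subgroup_M sgH (subgroup_M sgH (subgroup_V sgH Ht) Hh) Ht).
  by exists u; rewrite wval_conj -uE !mulgA mulgV mul1g mulgK.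
rewrite wval_conj => /(congr1 (fun x => t^-1 * x * t)).
by rewrite !mulgA mulVg mul1g mulgVK mulg1 mulVg; apply: fre.
Qed.

Lemma free_familyV H e :
  subgroup H -> free_family H e -> free_family H (fun i => (e i)^-1).
Proof.
move=> sgH fe; pose s i : word := [:: (i, true)].
by apply: (free_family_subst (sig := s) (tau := s) sgH fe) => i;
  rewrite wval1 // /lval /= ?wval1 /lval /= invgK.
Qed.

(** A reduced word in the values of [e] lifts to a reduced word in the indices
    whether or not [e] is known to be injective: distinct values have distinct
    indices. *)
Lemma group_basis_range H e : free_family H e -> group_basis H (range e).
Proof.
move=> fe; have [He ge fre] := fe.
pose wrd (u : word) : seq (F * bool) := [seq (e a.1, a.2) | a <- u].
have wrdE u : word_val (wrd u) = wval e u by rewrite /word_val big_map.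
split=> [_ [i _ <-] //|h /ge[u ->]|w].
  by exists (wrd u) => // a /mapP[b _ ->]; exists b.1.
have lift (v : seq (F * bool)) : word_in (range e) v -> exists u, v = wrd u.
  elim: v => [|a v IHv] vX; first by exists [::].
  have [i _ ia] := vX a (mem_head _ _).
  have [u ->] : exists u, v = wrd u.
    by apply: IHv => b bv; apply: vX; rewrite inE bv orbT.
  by exists ((i, a.2) :: u); rewrite /wrd /= ia; case: (a).
case/lift=> u -> ru u0; rewrite wrdE => /fre; case: u u0 ru => // a u _.
rewrite /reduced_word sorted_map => ru; suff /[swap] /[apply] : reduced (a :: u) by [].
apply: sub_sorted ru => b c; rewrite nocancelE => /orP[/=|->]; last by rewrite orbT.
by move=> ne; apply/orP; left; apply: contra ne => /eqP->.
Qed.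

Lemma free_family_group_primitive H e a :
  subgroup H -> free_family H e -> group_primitive H (lval e a).
Proof.
move=> sgH fe; rewrite /lval; case: a.2.
  exists (range (fun i => (e i)^-1)); last by exists a.1.
  exact: group_basis_range (free_familyV sgH fe).
by exists (range e); [exact: group_basis_range|exists a.1].
Qed.

End FreeFamilies.

Section FreeSubgroups.
Local Open Scope group_scope.

Lemma free_family_inj (F : groupType) (I : eqType) (H : set F) (e : I -> F) :
  free_family H e -> injective e.
Proof.
move=> fe i j eij.
suff [//] : [:: (i, false)] = [:: (j, false)].
by apply: (reduced_wval_inj fe); rewrite ?inE // !wval1 /lval /= eij.
Qed.

Lemma group_rank_free_family (F : groupType) (H : set F) n :
  group_rank H n -> exists e : 'I_n -> F, free_family H e.
Proof.
case=> X [XH gX frX] /card_esym /card_bijP[f [g fK gK]].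
pose idx (i : 'I_n) : `I_n := SigSub (mem_set (ltn_ord i : `I_n (val i))).
pose e i := val (f (idx i)); exists e.
have Xe i : X (e i) by exact: set_valP.
have einj : injective e.
  by move=> i j /val_inj /(can_inj fK) /(congr1 val) /= /val_inj.
pose wrd (u : seq ('I_n * bool)) := [seq (e a.1, a.2) | a <- u].
have wrdE u : word_val (wrd u) = wval e u by rewrite /word_val big_map.
split=> [i|h /gX[v vX ->]|u ru u1]; first exact: XH.
  suff [u ->] : exists u, v = wrd u by exists u.
  elim: v vX => [|a v IHv] vX; first by exists [::].
  have [i ia] : exists i, e i = a.1.
    pose k := g (SigSub (mem_set (vX a (mem_head _ _)))).
    exists (Ordinal (set_valP k)); rewrite /e.
    by rewrite (_ : idx _ = k) ?gK //; apply: val_inj.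
  have [u ->] : exists u, v = wrd u.
    by apply: IHv => b bv; apply: vX; rewrite inE bv orbT.
  by exists ((i, a.2) :: u); rewrite /wrd /= ia; case: (a).
case: u ru u1 => // a u ru; rewrite -wrdE => /frX; case=> //.
  by move=> b /mapP[c _ ->]; apply: Xe.
rewrite /reduced_word /wrd sorted_map; apply: sub_sorted ru => b c /=.
by rewrite nocancelE (inj_eq einj).
Qed.

End FreeSubgroups.

(** * Whitehead moves *)

Section SortedSplit.
Variables (T : eqType) (R : rel T).

Lemma sorted_split u :
  (forall s1 p q s2, u = s1 ++ p :: q :: s2 -> R p q) -> sorted R u.
Proof.
case: u => // a t; elim: t a => //= b t IHt a split_u.
rewrite (split_u [::] a b t) //=; apply: IHt => s1 p q s2 def_u.
by apply: (split_u (a :: s1) p q s2); rewrite def_u.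
Qed.

Lemma cycle_last a t : cycle R (a :: t) = R (last a t) a && sorted R (a :: t).
Proof. by rewrite /= rcons_path andbC. Qed.

End SortedSplit.

Lemma cycle_constant (T S : eqType) (g : T -> S) (u : seq T) :
  cycle (fun p q => g p == g q) u -> {in u &, forall x y, g x = g y}.
Proof.
case: u => // a t; rewrite cycle_last => /andP[_ /=].
have allE b s : path (fun p q => g p == g q) b s ->
    {in b :: s, forall x, g x = g b}.
  elim: s b => [|d s IHs] b /=; first by move=> _ x; rewrite inE => /eqP->.
  case/andP=> /eqP bd /IHs sd x; rewrite inE => /predU1P[-> //|xs].
  by rewrite bd sd.
by move/allE=> ga x y xu yu; rewrite (ga x xu) (ga y yu).
Qed.

Section WhiteheadMove.
Variables (F : groupType) (I : eqType) (H : set F) (e : I -> F).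
Local Notation letter := (I * bool)%type.
Local Notation word := (seq letter).
Hypotheses (sgH : subgroup H) (fe : free_family H e).
Local Open Scope group_scope.
Implicit Types (a b d p q n : letter) (t u : word).

Variables (c : letter) (s : letter -> bool).
Hypotheses (sc : s c = false) (scV : s (linv c) = false).

(** Read along the cyclic word, the junction of [p] and [q] is the edge
    ([linv p], [q]) of the Whitehead graph. *)
Definition compatible p q :=
  nocancel p q && [|| linv p == c, q == c | s (linv p) == s q].

(** In the new basis a letter equal to the pivot [c] is cancelled by the shift of
    its predecessor [p], and a letter [linv c] by that of its successor [n]. *)
Definition keep p a n :=
  ~~ ((a == c) && s (linv p)) && ~~ ((a == linv c) && s n).

Fixpoint prune p u q : word :=
  if u is a :: t then nseq (keep p a (head q t)) a ++ prune a t q else [::].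

Definition shift a : F := if s a then lval e c else 1.

(** The Whitehead automorphism with pivot [c]: the edges that leave the origin in
    the directions marked by [s] are slid along the edge [c]. *)
Definition whitehead_family i : F :=
  (shift (i, false))^-1 * e i * shift (i, true).

Let y := whitehead_family.

Lemma lval_whitehead a : lval y a = (shift a)^-1 * lval e a * shift (linv a).
Proof. by case: a => i []; rewrite /lval //= !invgM invgK mulgA. Qed.

Lemma lval_whitehead_pivot : lval y c = lval e c.
Proof. by rewrite lval_whitehead /shift sc scV invg1 mul1g mulg1. Qed.

Lemma free_whitehead : free_family H y.
Proof.
pose pw (b : bool) (a : letter) : word := nseq (s a) (if b then c else linv c).
pose sig i := pw false (i, false) ++ (i, false) :: pw true (i, true).
pose tau i := pw true (i, false) ++ (i, false) :: pw false (i, true).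
have pwE (f : I -> F) (b : bool) a :
    wval f (pw b a) = if s a then (if b then lval f c else (lval f c)^-1) else 1.
  rewrite /pw; case: (s a); last exact: wval_nil.
  by rewrite wval1; case: b; rewrite ?lval_linv.
have sigE (f : I -> F) i : wval f (sig i) =
    (if s (i, false) then lval f c else 1)^-1 * f i *
    (if s (i, true) then lval f c else 1).
  rewrite /sig wval_cat wval_cons !pwE /lval /= mulgA.
  by case: (s _); rewrite ?invg1.
have tauE (f : I -> F) i : wval f (tau i) =
    (if s (i, false) then lval f c else 1) * f i *
    (if s (i, true) then lval f c else 1)^-1.
  rewrite /tau wval_cat wval_cons !pwE /lval /= mulgA.
  by case: (s (i, true)); rewrite ?invg1.
apply: (free_family_subst (sig := sig) (tau := tau) sgH fe) => i.
- by rewrite sigE.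
- rewrite tauE lval_whitehead_pivot /y /whitehead_family /shift.
  by rewrite !mulgA mulgV mul1g mulgK.
rewrite sigE tauE; set f := fun j => wval e (tau j).
have -> : lval f c = lval e c.
  rewrite /lval /f tauE; case: c sc scV => k [] /=; rewrite /linv /= => -> ->;
  by rewrite invg1 mul1g mulg1.
by rewrite !mulgA mulVg mul1g mulgVK.
Qed.

(** A junction is trivial unless it touches the pivot [c]; then its shift is
    charged to the letter of the junction that is a power of the pivot. *)
Definition tail_shift p q : F := if linv p == c then shift q else 1.
Definition head_shift p q : F := if q == c then (shift (linv p))^-1 else 1.

Lemma junction p q : compatible p q ->
  (shift (linv p))^-1 * shift q = tail_shift p q * head_shift p q.
Proof.
rewrite /tail_shift /head_shift /nocancel => /andP[]; rewrite /nocancel.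
case: (eqVneq (linv p) c) => [->|_]; case: (eqVneq q c) => [->|_] //=.
- by move=> _ _; rewrite /shift sc invg1 mul1g mulg1.
- by move=> _ _; rewrite {2}/shift sc mulg1 mul1g.
by move=> _ /eqP sE; rewrite /shift sE mulVg mulg1.
Qed.

Lemma wval_keep p a n : wval y (nseq (keep p a n) a) =
  head_shift p a * lval y a * tail_shift a n.
Proof.
rewrite /keep /head_shift /tail_shift linv_eq.
case: (eqVneq a c) => [->|_] /=.
  rewrite eq_sym (negPf (linv_neq c)) /= andbT lval_whitehead_pivot mulg1 /shift.
  case: (s _); rewrite /= ?wval_nil ?mulVg //.
  by rewrite invg1 mul1g wval1 lval_whitehead_pivot.
case: (eqVneq a (linv c)) => [->|_] /=; last by rewrite wval1 mul1g mulg1.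
rewrite lval_linv lval_whitehead_pivot mul1g /shift.
case: (s _); rewrite /= ?wval_nil ?mulVg //.
by rewrite mulg1 wval1 lval_linv lval_whitehead_pivot.
Qed.

(** Between consecutive letters of [t] the shifts of the two neighbours meet and
    leave only what [junction] says, which [wval_keep] absorbs in the letters. *)
Lemma wval_prune p t q : path compatible p (rcons t q) ->
  (shift (linv p))^-1 * wval e t * shift q =
  tail_shift p (head q t) * wval y (prune p t q) * head_shift (last p t) q.
Proof.
elim: t p => [|a t IHt] p /=.
  by rewrite andbT => /junction pq; rewrite !wval_nil !mulg1.
case/andP=> /junction pa /IHt{}IHt.
have ea : lval e a = shift a * lval y a * (shift (linv a))^-1.
  by rewrite lval_whitehead !mulgA mulgV mul1g mulgK.
rewrite wval_cons wval_cat wval_keep ea.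
transitivity (((shift (linv p))^-1 * shift a) * lval y a *
              ((shift (linv a))^-1 * wval e t * shift q)).
  by rewrite !mulgA.
by rewrite pa IHt !mulgA.
Qed.

(** The shifts at the two ends of the cyclic word agree up to conjugation, and a
    conjugate of a basis is a basis. *)
Lemma whitehead_move a t : cycle compatible (a :: t) ->
  exists2 e', free_family H e' &
    wval e' (prune (last a t) (a :: t) a) = wval e (a :: t).
Proof.
move=> cu; have lu : compatible (last a t) a.
  by move: cu; rewrite cycle_last => /andP[].
have := @wval_prune (last a t) (a :: t) a; rewrite rcons_cons /= lu => /(_ cu).
set g := wval y _ => gE.
pose x := shift (linv (last a t)) * tail_shift (last a t) a.
exists (fun i => x * y i * x^-1).
  have Hlval b : H (lval e b).
    by rewrite -wval1; apply: wval_subgroup; case: fe.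
  have Hshift b : H (shift b) by rewrite /shift; case: (s b); case: sgH.
  apply: free_family_conj => //; first exact: free_whitehead.
  by apply: subgroup_M; rewrite // /tail_shift; case: (_ == c); case: sgH.
rewrite wval_conj -/g.
have -> : x^-1 = head_shift (last a t) a * (shift a)^-1.
  apply: (mulIg (shift a)); rewrite mulgVK /x invgM -mulgA (junction lu).
  by rewrite mulKg.
have -> : wval e (a :: t) = shift (linv (last a t)) *
    ((shift (linv (last a t)))^-1 * wval e (a :: t) * shift a) * (shift a)^-1.
  by rewrite !mulgA mulgV mul1g mulgK.
by rewrite gE /x !mulgA.
Qed.

Fixpoint all_kept p u q :=
  if u is a :: t then keep p a (head q t) && all_kept a t q else true.

Lemma size_prune p u q : size (prune p u q) <= size u ?= iff all_kept p u q.
Proof.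
elim: u p => [|a t IHt] p /=; first exact/leqif_refl.
rewrite size_cat size_nseq -add1n; apply: leqif_add => //.
by case: (keep _ _ _); split.
Qed.

Lemma all_kept_path p t q : path compatible p (rcons t q) -> all_kept p t q ->
    (linv p == c -> s (head q t) = false) ->
  path (fun x z => s (linv x) == s z) p t.
Proof.
elim: t p => //= a t IHt p /andP[/andP[_ pa] cat] /andP[ka kt] ph.
rewrite IHt // => [|/eqP ac].
  rewrite andbT; case/or3P: pa => [pc|/eqP ac|//].
    by rewrite (eqP pc) sc ph.
  by move: ka; rewrite /keep ac eqxx /= sc => /andP[/negPf-> _].
by move: ka; rewrite /keep -linv_eq ac eqxx /= => /andP[_ /negPf->].
Qed.

Lemma all_kept_last p t q : all_kept p t q -> t != [::] ->
  linv (last p t) == c -> s q = false.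
Proof.
elim: t p => //= a [|b t] IHt p /andP[ka kt] _; last exact: IHt.
by move=> /= ac; move: ka; rewrite /keep -linv_eq ac /= => /andP[_ /negPf->].
Qed.

Lemma all_kept_cycle a t : cycle compatible (a :: t) ->
  all_kept (last a t) (a :: t) a ->
  cycle (fun x z => s (linv x) == s z) (a :: t).
Proof.
move=> cu ku; have lu : compatible (last a t) a.
  by move: cu; rewrite cycle_last => /andP[].
suff pu : path (fun x z => s (linv x) == s z) (last a t) (a :: t).
  by rewrite cycle_last; move: pu => /= /andP[-> ->].
apply: (all_kept_path (q := a)); rewrite ?rcons_cons //=.
  by rewrite lu.
exact: (all_kept_last ku).
Qed.

End WhiteheadMove.

(** * The Whitehead graph of a shortest word *)

Section ShortestWord.
Variables (F : groupType) (I : eqType) (H : set F) (e : I -> F).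
Local Notation letter := (I * bool)%type.
Local Notation word := (seq letter).
Hypotheses (sgH : subgroup H) (fe : free_family H e).
Local Open Scope group_scope.
Implicit Types (b c d p q x z : letter).

Variable (a : letter) (t : word).
Local Notation u := (a :: t).
Hypothesis u_min : forall e' (v : word),
  free_family H e' -> wval e' v = wval e u -> (size u <= size v)%N.

Definition letter_of x := (x \in u) || (linv x \in u).

Lemma letter_of_linv x : letter_of (linv x) = letter_of x.
Proof. by rewrite /letter_of linvK orbC. Qed.

(** A cancellation at the closing junction is removed by conjugating the basis
    with the first letter. *)
Lemma shortest_cycle_reduced : cycle (@nocancel I) u.
Proof.
rewrite cycle_last; apply/andP; split; last first.
  apply: sorted_split => s1 p q s2 def_u; apply/negP => /eqP qE.
  have := u_min (v := s1 ++ s2) fe.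
  rewrite def_u qE !wval_cat !wval_cons lval_linv mulVKg => /(_ erefl).
  by rewrite !size_cat leq_add2l => /ltnW; rewrite ltnn.
case/lastP: t u_min => [|t' b] min; first by rewrite /nocancel eq_sym linv_neq.
rewrite last_rcons; apply/negP => /eqP aE.
have Ha : H (lval e a) by rewrite -wval1; apply: wval_subgroup; case: fe.
have := min _ t' (free_family_conj sgH fe Ha).
have -> : wval e (a :: rcons t' b) = lval e a * wval e t' * (lval e a)^-1.
  by rewrite wval_cons wval_rcons {3}aE lval_linv invgK mulgA.
rewrite wval_conj => /(_ erefl).
by rewrite /= size_rcons => /ltnW; rewrite ltnn.
Qed.

(** Whitehead's lemma: a colouring that only the edges at [c] may violate yields
    a Whitehead move around [c] that loses one letter for each violating edge;
    hence a shortest word has no violating edge. *)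
Lemma shortest_compatible c (s : letter -> bool) :
  s c = false -> s (linv c) = false ->
  cycle (fun p q => [|| linv p == c, q == c | s (linv p) == s q]) u ->
  cycle (fun p q => s (linv p) == s q) u.
Proof.
move=> sc scV su.
have cu : cycle (compatible c s) u.
  by rewrite (cycle_relI (@nocancel I)) shortest_cycle_reduced.
have [e' fe' /(u_min fe') le_u] := whitehead_move sgH fe sc scV cu.
apply: (all_kept_cycle sc cu).
by have [le_prune <-] := size_prune c s (last a t) u a; rewrite eqn_leq le_prune.
Qed.

(** If this failed, the letters other than [c] whose colour is not that of
    [linv c] would form, by [shortest_compatible], a union of components of the whole
    graph. If one of them occurs in this union without its inverse, a move around
    it would shorten the word; if not, the cyclic word never passes from a letter
    of the union to any other letter. *)
Lemma shortest_connected (S : eqType) (chi : letter -> S) c :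
  letter_of c ->
  cycle (fun p q => [|| linv p == c, q == c | chi (linv p) == chi q]) u ->
  forall x, letter_of x -> x != c -> chi x = chi (linv c).
Proof.
move=> lc chiu x lx xc; pose s z := (z != c) && (chi z != chi (linv c)).
have su : cycle (fun p q => s (linv p) == s q) u.
  apply: (@shortest_compatible c); rewrite /s ?eqxx ?andbF //.
  apply: sub_cycle chiu => p q /or3P[->//|->|/eqP ->]; first by rewrite orbT.
  by case: (linv p == c) => //=; case: (q == c) => //=; rewrite eqxx.
apply/eqP; apply: contraT => sx; have {sx xc}sx : s x by rewrite /s xc.
have sV z : letter_of z -> s z -> s (linv z).
  (* By [su] the neighbours of [z] are marked by [s]; by [s'u] they are not
     marked by [s'], so they could only be [z] itself. *)
  move=> lz sz; apply: contraT => szV; pose s' y := s y && (y != z).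
  have s'u : cycle (fun p q => s' (linv p) == s' q) u.
    apply: (@shortest_compatible z); rewrite /s' ?eqxx ?andbF ?(negPf szV) //.
    apply: sub_cycle su => p q /eqP ->.
    by case: (linv p == z) => //=; case: (q == z) => //=; rewrite eqxx.
  have nu := shortest_cycle_reduced.
  case/orP: lz => zu.
    have := prev_cycle nu zu; have /eqP := prev_cycle s'u zu.
    have /eqP := prev_cycle su zu; rewrite /s' eqxx sz andbF => -> /=.
    by move/negbFE/eqP; rewrite /nocancel => -> ; rewrite eqxx.
  have := next_cycle nu zu; have /eqP := next_cycle s'u zu.
  have /eqP := next_cycle su zu; rewrite /s' linvK eqxx sz /= => <- /=.
  by move/esym/negbFE/eqP; rewrite /nocancel linvK => ->; rewrite eqxx.
have sE z : letter_of z -> s (linv z) = s z.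
  move=> lz; apply/idP/idP => [|/sV->//].
  by rewrite -{2}[z]linvK; apply: sV; rewrite letter_of_linv.
have s1 : cycle (fun p q => s p == s q) u.
  have allu : all (mem u) u by apply/allP.
  by apply: sub_in_cycle allu su => p q pu _ /=; rewrite sE // /letter_of pu.
have sc : s c = false by rewrite /s eqxx.
have memE z : letter_of z -> exists2 y, y \in u & s y = s z.
  by move=> lz; case/orP: (lz) => zu; [exists z|exists (linv z); rewrite ?sE].
have [[y yu ys] [y' y'u y's]] := (memE c lc, memE x lx).
by have := cycle_constant s1 yu y'u; rewrite ys y's sc sx.
Qed.

(** A colouring violated by the closing edge alone is compatible off either end
    of that edge, so [shortest_connected] applies at both ends. The two results
    rule out a violation unless the word is a power of [a], and then its other
    edges join the same two letters as the closing one. *)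
Lemma shortest_bridgeless (S : eqType) (chi : letter -> S) :
  t != [::] -> sorted (fun p q => chi (linv p) == chi q) u ->
  chi (linv (last a t)) = chi a.
Proof.
move=> t0 chiu; set p := linv (last a t).
have lp : letter_of p by rewrite letter_of_linv /letter_of mem_last.
have la : letter_of a by rewrite /letter_of mem_head.
have cut c : (c == a) || (c == p) ->
    cycle (fun p q => [|| linv p == c, q == c | chi (linv p) == chi q]) u.
  move=> ca; rewrite cycle_last -/p; apply/andP; split.
    by case/orP: ca => /eqP->; rewrite eqxx ?orbT.
  by apply: sub_sorted chiu => x z ->; rewrite !orbT.
have [] := (shortest_connected la (cut a _), shortest_connected lp (cut p _)).
  by rewrite eqxx.
  by rewrite eqxx orbT.
move=> off_a off_p.
have pa : a != p.
  by move: shortest_cycle_reduced; rewrite cycle_last => /andP[].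
have [aV|aV] := eqVneq (linv a) p; last first.
  by rewrite (off_a p) 1?eq_sym // (off_p a) // (off_p (linv a)) ?letter_of_linv.
have [b [t' tE]] : exists b t', t = b :: t'.
  by case: (t) t0 => // b t' _; exists b, t'.
have := shortest_cycle_reduced; rewrite cycle_last => /andP[_].
move: chiu; rewrite tE /= => /andP[/eqP ab _] /andP[nab _].
have [ba|ba] := eqVneq b a; first by rewrite -aV ab ba.
have lb : letter_of b by rewrite /letter_of tE !inE eqxx orbT.
have bp : b != p by rewrite -aV.
by rewrite -aV -(off_a b lb ba) (off_p b lb bp) -aV linvK.
Qed.

End ShortestWord.

(** * Colourings of the ends of the Cayley tree *)

Section EndColouring.
Variables (F : groupType) (I : eqType) (H : set F) (e : I -> F).
Local Notation letter := (I * bool)%type.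
Local Notation word := (seq letter).
Hypotheses (sgH : subgroup H) (fe : free_family H e).
Local Open Scope group_scope.
Implicit Types (b c d p q v s : word) (x y z : letter).

Lemma wval_in p : H (wval e p).
Proof. by apply: wval_subgroup => //; case: fe. Qed.

Lemma reduced_wval_neq1 v : reduced v -> v != [::] -> wval e v <> 1.
Proof. by move=> rv /eqP v0 v1; apply: v0; case: fe => _ _; apply. Qed.

(** Reduced words are determined by their values, so finitely many values
    bound the length. *)
Lemma bounded_size (l : seq F) :
  exists N, forall v, reduced v -> wval e v \in l -> size v <= N.
Proof.
elim: l => [|g l [N vN]]; first by exists 0.
have [[v0 rv0 v0g]|no_v0] := pselect (exists2 v0, reduced v0 & wval e v0 = g).
  exists (maxn N (size v0)) => v rv; rewrite inE leq_max => /orP[/eqP vg|vl].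
    suff -> : v = v0 by rewrite leqnn orbT.
    by apply: (reduced_wval_inj fe); rewrite ?inE // v0g.
  by rewrite vN.
exists N => v rv; rewrite inE => /orP[/eqP vg|]; last exact: vN.
by case: no_v0; exists v.
Qed.

Variables (a : letter) (t : word).
Local Notation u := (a :: t).
Hypothesis u_min : forall e' (v : word),
  free_family H e' -> wval e' v = wval e u -> (size u <= size v)%N.

Local Notation letters := (all (letter_of a t)).

Variables (S : eqType) (f : F -> S) (N0 : nat).
Hypothesis f_far : forall v x, letter_of a t x -> reduced (rcons v x) ->
  N0 <= size v -> f (wval e (rcons v x)) = f (wval e v).
Hypothesis f_line :
  forall g, H g -> g * wval e u <> 1 -> f (g * wval e u) = f g.

Lemma f_tail p q : letters q -> reduced (p ++ q) -> N0 <= size p ->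
  f (wval e (p ++ q)) = f (wval e p).
Proof.
elim/last_ind: q => [|q x IHq]; first by rewrite cats0.
rewrite all_rcons -rcons_cat => /andP[lx lq] rqx Np.
rewrite f_far // ?IHq //; last by rewrite size_cat (leq_trans Np) ?leq_addr.
by move: rqx; rewrite -cats1 => /reduced_cat[].
Qed.

(** The colour of an end is the value of [f] at any reduced word of length at
    least [N0] on a ray to that end: from there on [f_far] keeps it constant. *)
Definition determined_by_prefix N := forall v v',
  reduced v -> reduced v' -> letters v -> letters v' ->
  N0 <= size v -> N0 <= size v' -> take N v = take N v' ->
  f (wval e v) = f (wval e v').

Lemma determined_far : determined_by_prefix N0.
Proof.
have fE v : reduced v -> letters v -> N0 <= size v ->
    f (wval e v) = f (wval e (take N0 v)).
  move=> rv lv Nv; rewrite -{1}(cat_take_drop N0 v) f_tail ?cat_take_drop //.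
    by move: lv; rewrite -{1}(cat_take_drop N0 v) all_cat => /andP[].
  by rewrite size_takel.
by move=> v v' rv rv' lv lv' Nv Nv' vv'; rewrite (fE v) // (fE v') // vv'.
Qed.

(** Repeating [x] is just one way to go far out on the branch of [rcons p x]; by
    [branchE] all other ways give the same value. *)
Definition branch p x := f (wval e (p ++ nseq N0.+1 x)).

Lemma letters_nseq n x : letter_of a t x -> letters (nseq n x).
Proof. by move=> lx; rewrite all_nseq lx orbT. Qed.

Lemma reduced_nseq n x : reduced (nseq n.+1 x).
Proof.
by elim: n => //= n IHn; rewrite /reduced /= /nocancel eq_sym linv_neq.
Qed.

Lemma branchE p x v : determined_by_prefix (size p).+1 ->
  letters (p ++ x :: v) -> reduced (p ++ x :: v) ->
  N0 <= size (p ++ x :: v) ->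
  f (wval e (p ++ x :: v)) = branch p x.
Proof.
move=> dp lv rv Nv.
have [lp lx] : letters p /\ letter_of a t x.
  by move: lv; rewrite all_cat /= => /and3P[].
have rpx : reduced (rcons p x).
  by move: rv; rewrite -cat_rcons => /reduced_cat[].
apply: dp => //.
- by apply: reduced_cat_cons => //; apply: reduced_nseq.
- by rewrite all_cat lp letters_nseq.
- by rewrite size_cat size_nseq addnS leqW ?leq_addl.
by rewrite -!cat_rcons !take_size_cat ?size_rcons.
Qed.

Definition wpow k : word := iter k (cat u) [::].

Lemma wpowS k : wpow k.+1 = u ++ wpow k. Proof. by []. Qed.

Lemma wpowSr k : wpow k.+1 = wpow k ++ u.
Proof. by elim: k => [|k IHk]; rewrite wpowS ?cats0 // {1}IHk catA. Qed.

Lemma size_wpow k : k <= size (wpow k).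
Proof. by elim: k => // k IHk; rewrite wpowS size_cat -add1n leq_add. Qed.

Lemma letters_u : letters u.
Proof. by apply/allP => x xu; rewrite /letter_of xu. Qed.

Lemma letters_wpow k : letters (wpow k).
Proof. by elim: k => // k IHk; rewrite wpowS all_cat letters_u. Qed.

Lemma letters_winv v : letters (winv v) = letters v.
Proof.
rewrite /winv all_rev all_map; apply: eq_all => x /=; exact: letter_of_linv.
Qed.

Lemma reduced_wpow k : reduced (wpow k).
Proof.
have: path (@nocancel I) (last a t) (wpow k).
  elim: k => // k IHk; rewrite wpowS cat_path IHk andbT.
  by have := shortest_cycle_reduced sgH fe u_min; rewrite cycle_last.
exact: path_sorted.
Qed.

(** The half of a translate of the axis that leaves the vertex [p] in the
    direction of the letter following [s1]; when [s2] is empty this is the first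
    letter of the next period. *)
Lemma branch_forward p s1 s2 : determined_by_prefix (size p).+1 ->
  u = s1 ++ s2 -> letters p -> reduced (rcons p (head a s2)) ->
  branch p (head a s2) = f (wval e (p ++ s2)).
Proof.
move=> dp def_u lp rp; set d := head a s2.
pose ray k := p ++ s2 ++ wpow k.
have [r rE] : exists r, forall k, s2 ++ wpow k.+1 = d :: r k.
  rewrite /d; case: (s2) => [|d' s'] /=; first by exists (fun k => t ++ wpow k).
  by exists (fun k => s' ++ u ++ wpow k).
have ls2 : letters s2 by move: letters_u; rewrite def_u all_cat => /andP[].
have rray k : reduced (ray k.+1).
  rewrite /ray rE; apply: reduced_cat_cons => //; rewrite -rE.
  have := reduced_wpow k.+2; rewrite wpowS {1}def_u -catA.
  by case/reduced_cat.
have fray k : f (wval e (ray k)) = f (wval e (p ++ s2)).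
  elim: k => [|k <-]; first by rewrite /ray cats0.
  have rayS : wval e (ray k.+1) = wval e (ray k) * wval e u.
    by rewrite -wval_cat /ray wpowSr !catA.
  rewrite rayS f_line //; first exact: wval_in.
  by rewrite -rayS; apply: reduced_wval_neq1; rewrite // /ray rE; case: (p).
rewrite -(fray N0.+1) /ray rE; apply/esym/branchE => //; rewrite -rE.
- by rewrite all_cat lp all_cat ls2 letters_wpow.
- exact: (rray N0).
rewrite size_cat size_cat addnA (leq_trans _ (leq_addl _ _)) //.
by rewrite ltnW // size_wpow.
Qed.

(** The other half of the same translate, which leaves [p] against the word. *)
Lemma branch_backward p s1 s2 x : determined_by_prefix (size p).+1 ->
  u = rcons s1 x ++ s2 -> letters p -> reduced (rcons p (linv x)) ->
  branch p (linv x) = f (wval e (p ++ winv (rcons s1 x))).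
Proof.
move=> dp def_u lp rp; set d := linv x.
pose ray k := p ++ winv (wpow k ++ rcons s1 x).
have rE k : winv (wpow k ++ rcons s1 x) = d :: winv (wpow k ++ s1).
  by rewrite -rcons_cat winv_rcons.
have ls1 : letters (rcons s1 x).
  by move: letters_u; rewrite def_u all_cat => /andP[].
have rray k : reduced (ray k).
  rewrite /ray rE; apply: reduced_cat_cons => //; rewrite -rE; apply: reduced_winv.
  by have := reduced_wpow k.+1; rewrite wpowSr def_u catA => /reduced_cat[].
have fray k : f (wval e (ray k)) = f (wval e (p ++ winv (rcons s1 x))).
  elim: k => [//|k <-].
  have rayS : wval e (ray k) = wval e (ray k.+1) * wval e u.
    by rewrite /ray wpowS -catA (winv_cat u) catA (wval_cat_winv e _ u) mulgVK.
  rewrite rayS f_line //; first exact: wval_in.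
  by rewrite -rayS; apply: reduced_wval_neq1; rewrite // /ray rE; case: (p).
rewrite -(fray N0) /ray rE; apply/esym/branchE => //; rewrite -rE.
- by rewrite all_cat lp letters_winv all_cat letters_wpow ls1.
- exact: (rray N0).
rewrite size_cat /winv size_rev size_map size_cat.
by rewrite (leq_trans (size_wpow _)) // addnCA leq_addr.
Qed.

(** Both halves have the same colour unless the translate is the axis of the
    word itself, which happens for [p ++ s2 = [::]]. *)
Lemma branch_edge p s1 x s2 : determined_by_prefix (size p).+1 ->
  u = rcons s1 x ++ s2 -> letters p ->
  reduced (rcons p (linv x)) -> reduced (rcons p (head a s2)) ->
  reduced (p ++ s2) -> p ++ s2 != [::] ->
  branch p (linv x) = branch p (head a s2).
Proof.
move=> dp def_u lp rx rs rps ps0.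
rewrite (branch_backward dp def_u lp rx) (branch_forward dp def_u lp rs).
have E : wval e (p ++ s2) = wval e (p ++ winv (rcons s1 x)) * wval e u.
  by rewrite def_u !wval_cat wval_winv mulgA mulgVK.
rewrite E f_line //; first exact: wval_in.
by rewrite -E; apply: reduced_wval_neq1.
Qed.

Lemma reduced_suffix s1 s2 : u = s1 ++ s2 -> reduced s2.
Proof.
move=> def_u; have := reduced_wpow 1; rewrite wpowS cats0 def_u.
by case/reduced_cat.
Qed.

(** Every edge of the Whitehead graph that avoids the direction from [p] back to
    the origin joins branches of the same colour, so [shortest_connected] makes
    all branches beyond [p] alike. *)
Lemma determined_descend N : 0 < N -> N < N0 ->
  determined_by_prefix N.+1 -> determined_by_prefix N.
Proof.
move=> N_gt0 ltN dN v v' rv rv' lv lv' Nv Nv' vv'.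
set p := take N v in vv'.
have szp : size p = N by rewrite size_takel // ltnW // (leq_trans ltN).
have dp : determined_by_prefix (size p).+1 by rewrite szp.
have split w : take N w = p -> N0 <= size w -> exists x r, w = p ++ x :: r.
  move=> wp Nw; move: (cat_take_drop N w); rewrite wp.
  case: (drop N w) (size_drop N w) => [/esym/eqP|x r _ <-]; last by exists x, r.
  by rewrite subn_eq0 leqNgt (leq_trans ltN Nw).
have [[x [r vE]] [x' [r' v'E]]] := (split v erefl Nv, split v' (esym vv') Nv').
rewrite vE v'E !branchE -?vE -?v'E // {split}.
have lp : letters p by move: lv; rewrite vE all_cat => /andP[].
have lx y s : letters (p ++ y :: s) -> letter_of a t y.
  by rewrite all_cat /= => /and3P[].
have [p' [z pE]] : exists p' z, p = rcons p' z.
  by case/lastP: (p) szp => [sz0|p' z _]; [rewrite -sz0 in N_gt0|exists p', z].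
have rp : reduced p by move: rv; rewrite vE => /reduced_cat[].
have redE y : reduced (rcons p y) = (y != linv z).
  have := rp; rewrite /reduced pE; case: (p') => [|b q] /=.
    by rewrite andbT.
  by move=> rq; rewrite rcons_path rq last_rcons.
have lz : letter_of a t z by move: lp; rewrite pE all_rcons => /andP[].
have edges : cycle (fun y y' =>
    [|| linv y == linv z, y' == linv z | branch p (linv y) == branch p y']) u.
  have edge s1 y s2 : u = rcons s1 y ++ s2 ->
      [|| linv y == linv z, head a s2 == linv z
        | branch p (linv y) == branch p (head a s2)].
    move=> def_u; have [//|yz] := eqVneq (linv y) (linv z).
    have [//|y'z] := eqVneq (head a s2) (linv z); apply/eqP.
    apply: (branch_edge dp def_u lp); rewrite ?redE //.
      case: s2 def_u y'z => [|d s2 def_u y'z]; first by rewrite [p ++ _]cats0.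
      by apply: reduced_cat_cons; rewrite ?redE ?(reduced_suffix def_u).
    by rewrite pE; case: (p').
  rewrite cycle_last; apply/andP; split.
    by apply: (edge (belast a t) _ [::]); rewrite cats0 lastI.
  apply: sorted_split => s1 y y' s2 def_u.
  by apply: (edge s1 y (y' :: s2)); rewrite cat_rcons.
have lzV : letter_of a t (linv z) by rewrite letter_of_linv.
have const := shortest_connected sgH fe u_min lzV edges.
have branchp y s : letters (p ++ y :: s) -> reduced (p ++ y :: s) ->
    branch p y = branch p z.
  rewrite -[z in RHS]linvK -cat_rcons => ly /reduced_cat[ry _].
  by apply: const; rewrite -?redE // (lx y s) // -cat_rcons.
by rewrite (branchp x r) -?vE // (branchp x' r') -?v'E.
Qed.

Lemma determined_by_first_letter : 0 < N0 -> determined_by_prefix 1.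
Proof.
move=> N0_gt0.
suff descend (d N : nat) : N + d = N0 -> 0 < N -> determined_by_prefix N.
  by apply: (descend N0.-1); rewrite // add1n prednK.
elim: d N => [|k IHk] N NdE N_gt0.
  by rewrite -[N]addn0 NdE; apply: determined_far.
apply: determined_descend; rewrite // -?NdE -?addSnnS ?leq_addr //.
by apply: IHk; rewrite // addSnnS.
Qed.

(** At the origin only the closing edge is special: its two branches carry the
    values of [f] at [1] and at the inverse of the word. *)
Lemma no_separating_colouring : 0 < N0 -> t != [::] -> f 1 = f (wval e u)^-1.
Proof.
move=> N0_gt0 t0; have d1 := determined_by_first_letter N0_gt0.
have edges : sorted (fun y y' => branch [::] (linv y) == branch [::] y') u.
  apply: sorted_split => s1 y y' s2 def_u; apply/eqP.
  apply: (@branch_edge [::] s1 y (y' :: s2)) => //; first by rewrite cat_rcons.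
  by apply: (@reduced_suffix (rcons s1 y)); rewrite cat_rcons.
have := shortest_bridgeless sgH fe u_min t0 edges.
rewrite (@branch_forward [::] u [::]) ?cats0 // wval_nil => <-.
rewrite (@branch_backward [::] (belast a t) [::]) ?cats0 -?lastI //.
by rewrite wval_winv.
Qed.

End EndColouring.

Section SeparatingFunction.
Local Open Scope group_scope.

Lemma shortest_word (F : groupType) (I : eqType) (H : set F) (e0 : I -> F) w :
  free_family H e0 -> H w ->
  exists e (u : seq (I * bool)), [/\ free_family H e, wval e u = w
    & forall e' (v : seq (I * bool)),
        free_family H e' -> wval e' v = w -> size u <= size v].
Proof.
move=> fe0 Hw.
pose P n := `[< exists e (u : seq (I * bool)),
  [/\ free_family H e, wval e u = w & size u = n] >].
have exP : exists n, P n.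
  have [u uE] : exists u, w = wval e0 u by case: fe0 => _ /(_ w Hw).
  by exists (size u); apply/asboolP; exists e0, u.
case: (ex_minnP exP) => n /asboolP[e [u [fe uw un]]] n_min.
exists e, u; split=> // e' v fe' vw; rewrite un; apply: n_min.
by apply/asboolP; exists e', v.
Qed.

Theorem separating_function_primitive (F : groupType) (I : eqType) (H : set F)
    (e0 : I -> F) (w : F) (S : eqType) (f : F -> S) :
  subgroup H -> free_family H e0 -> H w ->
  (forall h, H h -> exists l : seq F,
     forall g, H g -> g * h \notin l -> f (g * h) = f g) ->
  (forall g, H g -> g * w <> 1 -> f (g * w) = f g) ->
  f 1 <> f w^-1 -> group_primitive H w.
Proof.
move=> sgH fe0 Hw f_almost f_line f_sep.
have [e [u [fe uw u_min]]] := shortest_word fe0 Hw.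
case: u uw u_min => [|a t] uw u_min.
  by case: f_sep; rewrite -uw wval_nil invg1.
have [t0|t0] := eqVneq t [::].
  by rewrite -uw t0 wval1; apply: free_family_group_primitive.
case: f_sep; move: u_min f_line; rewrite -{}uw => u_min f_line.
have Hv v : H (wval e v) by apply: (wval_in sgH fe).
have [N far] : exists N, forall x v, letter_of a t x ->
    reduced (rcons v x) -> N <= size v ->
    f (wval e (rcons v x)) = f (wval e v).
  suff [N far] : exists N, forall x v, x \in (a :: t) ++ winv (a :: t) ->
      reduced (rcons v x) -> N <= size v ->
      f (wval e (rcons v x)) = f (wval e v).
    exists N => x v lx; apply: far; rewrite mem_cat /winv mem_rev.
    case/orP: lx => [->//|xu]; rewrite -[x in X in _ || X]linvK.
    by rewrite map_f ?orbT // .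
  elim: (_ ++ _) => [|y l [N far]]; first by exists 0.
  have [s sE] := f_almost _ (Hv [:: y]).
  have [M sM] := bounded_size fe s.
  exists (maxn N M) => x v; rewrite inE geq_max => xl rvx /andP[Nv Mv].
  case/orP: xl => [/eqP xy|xl]; last exact: far.
  rewrite wval_rcons -wval1 xy; apply: sE => //; apply/negP.
  rewrite -wval_cat cats1 -xy => /(sM _ rvx).
  by rewrite size_rcons leqNgt ltnS Mv.
apply: (no_separating_colouring sgH fe u_min (N0 := N.+1) _ f_line) => //.
by move=> v x lx rvx Nv; apply: far => //; apply: ltnW.
Qed.

End SeparatingFunction.

(** * The group algebra and the ideal generated by a free family *)

Section GroupAlgebraTheory.
Variables (K : nzRingType) (F : groupType).
Local Open Scope ring_scope.
Local Notation A := (group_algebra K F).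
Implicit Types (x y g : F) (a b : A).

Lemma group_elt1 : group_elt K 1%g = 1 :> A. Proof. by []. Qed.

Lemma group_eltM x y : group_elt K (x * y)%g = group_elt K x * group_elt K y.
Proof. by rewrite /GRing.mul /= /group_elt ga_mulUU mulr1. Qed.

Lemma mulUUE (c d : K) x y :
  (<< c *g x >> : A) * (<< d *g y >> : A) = << c * d *g (x * y)%g >>.
Proof. exact: ga_mulUU. Qed.

Lemma group_elt_mul x a :
  group_elt K x * a = \sum_(y <- msupp a) << a@_y *g (x * y)%g >>.
Proof.
rewrite {1}[a]monalgE mulr_sumr; apply: eq_bigr => y _.
by rewrite mulUUE mul1r.
Qed.

Lemma mul_group_elt a x :
  a * group_elt K x = \sum_(y <- msupp a) << a@_y *g (y * x)%g >>.
Proof.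
rewrite {1}[a]monalgE mulr_suml; apply: eq_bigr => y _.
by rewrite mulUUE mulr1.
Qed.

Lemma coef_group_elt_mul x a g : (group_elt K x * a)@_g = a@_(x^-1 * g)%g.
Proof.
rewrite group_elt_mul {3}[a]monalgE !raddf_sum /=; apply: eq_bigr => y _.
by rewrite !mcoeffU -[in RHS](inj_eq (mulgI x)) mulVKg.
Qed.

Lemma coef_mul_group_elt a x g : (a * group_elt K x)@_g = a@_(g * x^-1)%g.
Proof.
rewrite mul_group_elt {3}[a]monalgE !raddf_sum /=; apply: eq_bigr => y _.
by rewrite !mcoeffU -[in RHS](inj_eq (mulIg x)) mulgVK.
Qed.

Definition augmentation a : K := \sum_(x <- msupp a) a@_x.

Lemma augmentationE a (d : {fset F}) : (msupp a `<=` d)%fset ->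
  augmentation a = \sum_(x <- d) a@_x.
Proof. by move=> ad; apply: big_fset_incl => // x _ /mcoeff_outdom. Qed.

Lemma augmentationD : {morph augmentation : a b / a + b}.
Proof.
move=> a b; rewrite (augmentationE (msuppD_le a b)).
rewrite (augmentationE (fsubsetUl _ (msupp b))).
rewrite (augmentationE (fsubsetUr (msupp a) _)) -big_split /=.
by apply: eq_bigr => x _; rewrite mcoeffD.
Qed.

Lemma augmentation0 : augmentation 0 = 0.
Proof. by rewrite /augmentation msupp0 big_seq_fset0. Qed.

Lemma augmentationU (c : K) x : augmentation << c *g x >> = c.
Proof. by rewrite (augmentationE msuppU_le) big_seq_fset1 mcoeffUU. Qed.

Lemma augmentation_mul x a : augmentation (group_elt K x * a) = augmentation a.
Proof.
rewrite group_elt_mul (big_morph _ augmentationD augmentation0).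
by apply: eq_bigr => y _; rewrite augmentationU.
Qed.

End GroupAlgebraTheory.

Section AugmentationIdeal.
Variables (K : nzRingType) (F : groupType) (n : nat).
Variables (H : set F) (e : 'I_n -> F).
Hypotheses (fe : free_family H e).
Local Open Scope ring_scope.
Local Open Scope classical_set_scope.
Local Notation A := (group_algebra K F).
Local Notation elt := (group_elt K).

(** The right ideal generated by all [h - 1] with [h] in the subgroup. *)
Definition fox_ideal : set A :=
  [set f | exists c : 'I_n -> A, f = \sum_i (elt (e i) - 1) * c i].

Lemma fox_ideal_right : right_ideal fox_ideal.
Proof.
split=> [|f g [c ->] [d ->]|f a [c ->]].
- by exists (fun=> 0); rewrite big1 // => i _; rewrite mulr0.
- exists (fun i => c i + d i); rewrite -big_split /=.
  by apply: eq_bigr => i _; rewrite mulrDr.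
exists (fun i => c i * a); rewrite mulr_suml.
by apply: eq_bigr => i _; rewrite mulrA.
Qed.

Lemma fox_ideal_proper : fox_ideal <> setT.
Proof.
move=> IT; have : fox_ideal 1 by rewrite IT.
case=> c /(congr1 (@augmentation K F)).
rewrite (big_morph _ (@augmentationD K F) (@augmentation0 K F)) big1.
  by rewrite -group_elt1 augmentationU => /eqP; rewrite oner_eq0.
move=> i _; apply: (addIr (augmentation (1 * c i))).
by rewrite -augmentationD -mulrDl subrK augmentation_mul mul1r add0r.
Qed.

Lemma fox_ideal_family i : fox_ideal (elt (e i) - 1).
Proof.
exists (fun j => (j == i)%:R); rewrite (bigD1 i) //= eqxx mulr1.
by rewrite big1 ?addr0 // => j /negPf->; rewrite mulr0.
Qed.

(** From the product rule gh - 1 = (g - 1)h + (h - 1). *)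
Lemma fox_ideal_elt h : H h -> fox_ideal (elt h - 1).
Proof.
have [I0 ID IM] := fox_ideal_right.
case: fe => _ ge _ /ge[u ->]; elim: u => [|a u IHu].
  by rewrite wval_nil group_elt1 subrr.
have -> : elt (wval e (a :: u)) - 1 =
    (elt (lval e a) - 1) * elt (wval e u) + (elt (wval e u) - 1).
  by rewrite wval_cons group_eltM mulrBl mul1r addrA subrK.
apply: (ID) => //; apply: (IM); rewrite /lval.
case: a.2; last exact: fox_ideal_family.
have -> : elt (e a.1)^-1 - 1 = (elt (e a.1) - 1) * - elt (e a.1)^-1.
  by rewrite mulrN mulrBl mul1r -group_eltM mulgV group_elt1 opprB.
exact/IM/fox_ideal_family.
Qed.

Lemma elt_sub1_inj : injective (fun x : F => elt x - 1).
Proof.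
move=> x y /addIr /(congr1 (fun a : A => a@_x)); rewrite !mcoeffU eqxx.
by case: eqVneq => [->//|_] /eqP; rewrite oner_eq0.
Qed.

End AugmentationIdeal.

Arguments fox_ideal K [F n] e.

Section FoxIndependence.
Variables (K : nzRingType) (F : groupType) (n : nat).
Variables (H : set F) (e : 'I_n -> F).
Hypotheses (fe : free_family H e).
Local Open Scope ring_scope.
Local Notation A := (group_algebra K F).
Local Notation elt := (group_elt K).
Local Notation letter := ('I_n * bool)%type.

(** Think of [k i g] as the weight of the edge from [g] to [e i * g] of the
    Cayley tree; the second hypothesis says that the weights form a cycle. An
    edge of its support farthest from the origin would have an end that lies on
    no other edge of the support, so the weights vanish by descending induction
    on the length. *)
Lemma finite_tree_cycle (k : 'I_n -> F -> K) (l : seq F) :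
  (forall i g, g \notin l -> k i g = 0) ->
  (forall g, \sum_i (k i ((e i)^-1 * g)%g - k i g) = 0) ->
  forall i, k i 1%g = 0.
Proof.
move=> k_fin k_cycle.
pose edge (x : letter) (v : seq letter) :=
  k x.1 (if x.2 then wval e (x :: v) else wval e v).
have [N vN] := bounded_size fe l.
have edge0 m x v : (N < m + size v)%N -> reduced (x :: v) -> edge x v = 0.
  elim: m x v => [|m IHm] x v szv rv.
    apply: k_fin; apply/negP => vl; move: szv; rewrite add0n ltnNge.
    move: vl; case: x.2 => vl; last by rewrite (vN v) // (reduced_cons rv).
    by rewrite ltnW // -[(_ < _)%N]/((size (x :: v) <= N)%N) vN.
  have szxv : (N < m + size (x :: v))%N by rewrite -addSnnS.
  have step y : nocancel y x -> edge y (x :: v) = 0.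
    by move=> yx; apply: IHm => //; rewrite /reduced /= yx.
  have kV i : nocancel (i, true) x -> k i ((e i)^-1 * wval e (x :: v))%g = 0.
    by move/step; rewrite /edge /= wval_cons.
  have k1 i : nocancel (i, false) x -> k i (wval e (x :: v)) = 0 by move/step.
  have := k_cycle (wval e (x :: v)); rewrite (bigD1 x.1) //= big1 => [|i ix].
    rewrite addr0 /edge; case: x {rv szv szxv step} kV k1 => i [] /= kV k1.
      rewrite kV ?nocancelE ?eqxx ?orbT // sub0r => /eqP.
      by rewrite oppr_eq0 => /eqP.
    rewrite k1 ?nocancelE ?eqxx ?orbT // subr0.
    by rewrite {1}wval_cons {1}/lval /= mulKg.
  by rewrite kV ?k1 ?subr0 // nocancelE ix.
move=> i; rewrite -(wval_nil e).
by apply: (edge0 N.+1 (i, false) [::]); rewrite ?addn0.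
Qed.

(** Translating by [g], the coefficients of a relation on the coset [H g] become
    edge weights on the Cayley tree of [H]. *)
Lemma fox_independent (c : 'I_n -> A) :
  \sum_i (elt (e i) - 1) * c i = 0 -> forall i, c i = 0.
Proof.
move=> c0 i; apply/malgP => g; rewrite mcoeff0.
pose l := flatten [seq [seq (y * g^-1)%g | y <- enum_fset (msupp (c j))]
                  | j <- enum 'I_n].
pose k j x := (c j)@_(x * g)%g.
suff <- : k i 1%g = 0 by rewrite /k mul1g.
apply: (@finite_tree_cycle k l) => [j x xl|x].
  apply/eqP; rewrite mcoeff_eq0; apply: contra xl => xs.
  apply/flattenP; eexists; first by apply: map_f (mem_enum _ j).
  by apply/mapP; exists (x * g)%g; rewrite ?mulgK.
have := congr1 (mcoeff (x * g)%g) c0; rewrite mcoeff0 raddf_sum /= => cg.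
rewrite -[RHS]cg.
apply: eq_bigr => j _.
by rewrite mulrBl mul1r mcoeffB coef_group_elt_mul /k mulgA.
Qed.

End FoxIndependence.

Section FoxIdealRank.
Variables (K : nzRingType) (F : groupType) (n : nat).
Variables (H : set F) (e : 'I_n -> F).
Hypotheses (fe : free_family H e).
Local Open Scope ring_scope.
Local Open Scope classical_set_scope.
Local Notation A := (group_algebra K F).

Let E i : A := group_elt K (e i) - 1.

Let E_inj : injective E.
Proof. by move=> i j /elt_sub1_inj /(free_family_inj fe). Qed.

Lemma fox_ideal_basis : ideal_basis (fox_ideal K e) (range E).
Proof.
split; first split=> [_ [i _ <-]|_ [c ->]]; first exact: fox_ideal_family.
  exists [seq E i | i <- enum 'I_n].
  exists (fun b => if [pick i | E i == b] is Some i then c i else 0).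
  split=> [b /mapP[i _ ->]|]; first by exists i.
  rewrite big_map big_enum; apply: eq_bigr => i _.
  by case: pickP => [j /eqP/E_inj->//|/(_ i)]; rewrite eqxx.
move=> s c us sE c0 b bs; have [i _ bE] := sE b bs.
have := fox_independent fe (c := fun j => if E j \in s then c (E j) else 0).
move=> /(_ _ i); rewrite bE bs; apply; rewrite -[RHS]c0.
have sE' : perm_eq s [seq E j | j <- enum 'I_n & E j \in s].
  apply: uniq_perm => //.
    by rewrite map_inj_uniq // filter_uniq // enum_uniq.
  move=> d; apply/idP/mapP => [ds|[j]]; last first.
    by rewrite mem_filter => /andP[js _] ->.
  have [j _ jE] := sE d ds; exists j => //.
  by rewrite mem_filter jE ds mem_enum.
rewrite (perm_big _ sE') big_map big_filter big_enum_cond [RHS]big_mkcond /=.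
by apply: eq_bigr => j _; case: ifP => // _; rewrite mulr0.
Qed.

Lemma fox_ideal_rank : ideal_rank (fox_ideal K e) n.
Proof.
exists (range E); first exact: fox_ideal_basis.
apply: (card_eq_trans (inj_card_eq _)); last exact/card_esym/card_II.
by move=> i j _ _ /E_inj.
Qed.

End FoxIdealRank.

Section Coordinate.
Variables (A : nzRingType) (I B : set A) (b0 : A).
Hypotheses (rI : right_ideal I) (basisB : ideal_basis I B) (Bb0 : B b0).
Local Open Scope ring_scope.
Local Open Scope classical_set_scope.

(** Lists of pairs (basis element, coefficient); unlike families indexed by
   duplicate-free lists, they can be added by concatenation. *)
Let value (P : seq (A * A)) : A := \sum_(q <- P) q.1 * q.2.
Let coef (b : A) (P : seq (A * A)) : A := \sum_(q <- P | q.1 == b) q.2.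

Lemma coef_value0 P : (forall q, q \in P -> B q.1) -> value P = 0 ->
  coef b0 P = 0.
Proof.
move=> PB P0; set s := undup [seq q.1 | q <- P].
have sE : \sum_(b <- s) b * coef b P = 0.
  rewrite -[RHS]P0 /value /coef.
  rewrite [RHS](eq_big_seq (fun q => \sum_(b <- s | q.1 == b) b * q.2)) => [|q qP].
    rewrite (exchange_big_dep xpredT) //=.
    by apply: eq_bigr => b _; rewrite mulr_sumr.
  rewrite -big_filter (_ : filter _ _ = [:: q.1]) ?big_seq1 //.
  rewrite (eq_filter (a2 := pred1 q.1)) => [|b]; last by rewrite /= eq_sym.
  by rewrite filter_pred1_uniq ?undup_uniq // mem_undup map_f.
have [b0s|b0s] := boolP (b0 \in s).
  apply: (basisB.2 s (coef^~ P)) => //; first exact: undup_uniq.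
  by move=> b; rewrite /= mem_undup => /mapP[q qP ->]; apply: PB.
rewrite /coef big_seq_cond big_pred0 // => q; apply/negP => /andP[qP /eqP qb].
by case/negP: b0s; rewrite mem_undup -qb map_f.
Qed.

(** The coordinate with respect to [b0] is well defined, since two expansions of
    the same element differ by a relation. *)
Lemma coordinate_exists : exists phi : A -> A,
  [/\ forall f g, I f -> I g -> phi (f + g) = phi f + phi g,
      forall f a, I f -> phi (f * a) = phi f * a & phi b0 = 1].
Proof.
have [[BI gB] _] := basisB.
have repr f : exists P, I f -> (forall q, q \in P -> B q.1) /\ value P = f.
  have [If|nIf] := pselect (I f); last by exists [::].
  have [s [c [sB ->]]] := gB f If; exists [seq (b, c b) | b <- s] => _.
  split=> [_ /mapP[b bs ->]|]; first exact: sB.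
  by rewrite /value big_map.
have [P PE] := choice repr.
have coef_cat b P1 P2 : coef b (P1 ++ P2) = coef b P1 + coef b P2.
  by rewrite /coef big_cat.
have value_cat P1 P2 : value (P1 ++ P2) = value P1 + value P2.
  by rewrite /value big_cat.
pose scale a (P1 : seq (A * A)) := [seq (q.1, q.2 * a) | q <- P1].
have coef_scale b a P1 : coef b (scale a P1) = coef b P1 * a.
  by rewrite /coef big_map mulr_suml.
have value_scale a P1 : value (scale a P1) = value P1 * a.
  by rewrite /value big_map mulr_suml; apply: eq_bigr => q _; rewrite mulrA.
have coef_eq P1 P2 : (forall q, q \in P1 -> B q.1) ->
    (forall q, q \in P2 -> B q.1) -> value P1 = value P2 ->
    coef b0 P1 = coef b0 P2.
  move=> P1B P2B P12; apply/eqP; rewrite -subr_eq0; apply/eqP.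
  rewrite -(mulrN1 (coef b0 P2)) -coef_scale -coef_cat; apply: coef_value0.
    by move=> q; rewrite mem_cat => /orP[/P1B//|/mapP[q' /P2B q'B ->]].
  by rewrite value_cat value_scale mulrN1 P12 subrr.
have [_ ID IM] := rI.
have Ib0 : I b0 by apply: BI.
exists (fun f => coef b0 (P f)); split=> [f g If Ig|f a If|].
- have [[PfB Pf] [PgB Pg]] := (PE f If, PE g Ig).
  have [PB PV] := PE _ (ID f g If Ig).
  rewrite -coef_cat; apply: coef_eq => //; last by rewrite value_cat Pf Pg.
  by move=> q; rewrite mem_cat => /orP[/PfB|/PgB].
- have [PfB Pf] := PE f If; have [PB PV] := PE _ (IM f a If).
  rewrite -coef_scale; apply: coef_eq => //; last by rewrite value_scale Pf.
  by move=> _ /mapP[q /PfB qB ->].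
have [PB PV] := PE b0 Ib0.
rewrite (coef_eq _ [:: (b0, 1)] PB) ?/coef ?big_mkcond ?big_seq1 /= ?eqxx //.
  by move=> q; rewrite inE => /eqP->.
by rewrite PV /value big_seq1 mulr1.
Qed.

End Coordinate.

Section Primitivity.
Variables (K : nzRingType) (F : groupType) (n : nat).
Variables (H : set F) (e : 'I_n -> F).
Hypotheses (sgH : subgroup H) (fe : free_family H e).
Local Open Scope ring_scope.
Local Notation elt := (group_elt K).

Lemma ideal_primitive_group_primitive w : H w ->
  ideal_primitive (fox_ideal K e) (elt w - 1) -> group_primitive H w.
Proof.
move=> Hw [B basisB Bw].
have [phi [phiD phiM phi1]] := coordinate_exists (fox_ideal_right K e) basisB Bw.
pose D h := phi (elt h - 1); pose f (g : F) : K := (D g)@_g.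
have fM g h : H g -> H h -> f (g * h)%g = f g + (D h)@_(g * h)%g.
  move=> Hg Hh; rewrite /f /D.
  have Ig : fox_ideal K e (elt g - 1) by exact: (fox_ideal_elt K fe Hg).
  have Ih : fox_ideal K e (elt h - 1) by exact: (fox_ideal_elt K fe Hh).
  have -> : elt (g * h)%g - 1 = (elt g - 1) * elt h + (elt h - 1).
    by rewrite group_eltM mulrBl mul1r addrA subrK.
  have [_ _ IM] := fox_ideal_right K e.
  by rewrite phiD ?phiM ?mcoeffD ?coef_mul_group_elt ?mulgK //; apply: IM.
have H1 : H 1%g by case: sgH.
have fw g : H g -> f (g * w)%g = f g + (g * w == 1)%g%:R.
  by move=> Hg; rewrite fM // /D phi1 -group_elt1 mcoeffU eq_sym.
apply: (separating_function_primitive (f := f) sgH fe Hw).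
- move=> h Hh; exists (msupp (D h)) => g Hg gh; rewrite fM //.
  by rewrite mcoeff_outdom ?addr0.
- by move=> g Hg /eqP/negPf gw; rewrite fw // gw addr0.
have := fw w^-1%g (subgroup_V sgH Hw); rewrite mulVg eqxx => -> /esym/eqP.
by rewrite -subr_eq0 opprD addrA subrr sub0r oppr_eq0 oner_eq0.
Qed.

End Primitivity.

(** * Comparison of the two ranks *)

Lemma le_min_natinf (S T : set nat) : (S `<=` T)%classic ->
  le_natinf (min_natinf T) (min_natinf S).
Proof.
move=> ST; rewrite /min_natinf.
case: pselect => [exT|noT]; case: pselect => [exS|_] //; last first.
  by case: noT; case: exS => n /asboolP/ST Tn; exists n; apply/asboolP.
case: (ex_minnP exT) => m _ m_min; case: (ex_minnP exS) => k /asboolP/ST kT _.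
exact/m_min/asboolP.
Qed.

Theorem proposition1p8 (F : groupType) (r : nat) (hr : 1 <= r)
    (hF : is_free_group_of_rank F r)
    (p k q : nat) (hp : prime p) (hk : 0 < k) (hq : q = p ^ k)
    (K : finFieldType) (hK : #|K| = q) (w : F) :
  le_natinf (q_primitivity_rank K w) (primitivity_rank w).
Proof.
apply: le_min_natinf => n [H [sgH /group_rank_free_family[e fe] Hw w_imprim]].
exists (fox_ideal K e); split.
- exact: fox_ideal_right.
- exact: fox_ideal_proper.
- exact: (fox_ideal_rank K fe).
- exact: (fox_ideal_elt K fe).
by move=> /(ideal_primitive_group_primitive sgH fe Hw).
Qed.
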